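(* Let $p$ be an odd prime and $\alpha\in\mathbb{Z}_p$, and let $$S=\sum_{k=0}^{p-1}\frac{(\alpha)_k(1-\alpha)_k(\frac12)_k}{(k!)^3},\qquad T=\frac{\Gamma_p(\frac12)^2}{\Gamma_p(1-\frac12\alpha)^2\Gamma_p(\frac12+\frac12\alpha)^2}.$$ If $\langle-\alpha\rangle_p$ is even, then $S\equiv T\pmod{p^3}$. If $\langle-\alpha\rangle_p$ is odd, then $S\equiv\frac{p^2\alpha_p^*(\alpha_p^*-1)}{4}\,T\pmod{p^3}$.
   Context: $(x)_k=x(x+1)\cdots(x+k-1)$, $(x)_0=1$. $\langle x\rangle_p\in\{0,\ldots,p-1\}$ is the least nonnegative residue of $x\in\mathbb{Z}_p$ mod $p$, and $\alpha_p^*=(\alpha+\langle-\alpha\rangle_p)/p$. $\Gamma_p$ is Morita's $p$-adic Gamma function: $\Gamma_p(0)=1$, $\Gamma_p(n)=(-1)^n\prod_{1\leq k<n,\ p\nmid k}k$ for integers $n\geq1$, extended continuously to $\mathbb{Z}_p$.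
   Formalization: The case of even ⟨-α⟩_p is stated only for p ≠ 3, since it fails at p = 3: for α = 4 one has ⟨-4⟩_3 = 2, S = 25/4 and T = 4, so S − T = 9/4 is not 0 mod 27. The odd case is stated for all odd primes p. *)

(* Defs.v *)
From HB Require Import structures.
From mathcomp Require Import all_boot all_order all_algebra cyclic.
From mathcomp Require Import boolp classical_sets.
From mathcomp Require Import zify ring.

Set Implicit Arguments.
Unset Strict Implicit.
Unset Printing Implicit Defensive.

Import GRing.Theory.

(* The ring Z_p as the inverse limit of the Z/p^n: [zres x n] is the least
   nonnegative residue of [x] modulo p^n. *)
Record padic_int (p : nat) (pr_p : prime p) := PadicInt {
  zres : nat -> nat;
  zres_coherent : forall n, zres n.+1 %% p ^ n = zres n
}.

Notation "''Zp[' pr_p ]" := (padic_int pr_p)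
  (at level 0, pr_p at level 200, format "''Zp[' pr_p ]") : type_scope.

HB.instance Definition _ p (pr_p : prime p) := gen_eqMixin 'Zp[pr_p].
HB.instance Definition _ p (pr_p : prime p) := gen_choiceMixin 'Zp[pr_p].

Section PadicRing.
Context (p : nat) (pr_p : prime p).
Implicit Types x y z : 'Zp[pr_p].

Lemma expp_gt0 n : 0 < p ^ n.
Proof. by rewrite expn_gt0 prime_gt0. Qed.

Lemma zres_lt x n : zres x n < p ^ n.
Proof. by rewrite -(zres_coherent x n) ltn_mod expp_gt0. Qed.

Lemma zres_mod x n : zres x n %% p ^ n = zres x n.
Proof. by rewrite modn_small ?zres_lt. Qed.

Lemma zres_trunc x n m : n <= m -> zres x m %% p ^ n = zres x n.
Proof.
move=> /subnK <-; elim: (m - n) => [|d IH]; first by rewrite zres_mod.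
rewrite addSn -{}IH -(zres_coherent x (d + n)) modn_dvdm //.
by rewrite dvdn_exp2l // leq_addl.
Qed.

Lemma zres_inj x y : (forall n, zres x n = zres y n) -> x = y.
Proof.
case: x y => [f Hf] [g Hg] /= /funext Efg; case: g / Efg Hg => Hg.
by congr PadicInt; apply: Prop_irrelevance.
Qed.

Definition coherent (f : nat -> nat) := forall n, f n.+1 = f n %[mod p ^ n].

Lemma mkZp_subproof f : coherent f ->
  forall n, (f n.+1 %% p ^ n.+1) %% p ^ n = f n %% p ^ n.
Proof. by move=> Hf n; rewrite modn_dvdm ?dvdn_exp2l. Qed.

Definition mkZp f (Hf : coherent f) : 'Zp[pr_p] :=
  PadicInt pr_p (mkZp_subproof Hf).

Lemma nat_subproof k : coherent (fun=> k).
Proof. by []. Qed.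

Lemma add_subproof x y : coherent (fun n => zres x n + zres y n).
Proof. by move=> n; rewrite -modnDm !zres_coherent. Qed.

Lemma mul_subproof x y : coherent (fun n => zres x n * zres y n).
Proof. by move=> n; rewrite -modnMm !zres_coherent. Qed.

Lemma opp_subproof x : coherent (fun n => p ^ n - zres x n).
Proof.
move=> n; apply/eqP; rewrite -(eqn_modDr (zres x n)).
rewrite subnK ?(ltnW (zres_lt _ _)) // -modnDmr -{1}(zres_coherent x n).
by rewrite modn_mod modnDmr subnK ?(ltnW (zres_lt _ _)) // expnS modnn modnMl.
Qed.

Definition natZp k := mkZp (nat_subproof k).
Definition addZp x y := mkZp (add_subproof x y).
Definition mulZp x y := mkZp (mul_subproof x y).
Definition oppZp x := mkZp (opp_subproof x).

Lemma addZpA : associative addZp.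
Proof.
by move=> x y z; apply: zres_inj => n /=; rewrite modnDmr modnDml addnA.
Qed.

Lemma addZpC : commutative addZp.
Proof. by move=> x y; apply: zres_inj => n /=; rewrite addnC. Qed.

Lemma add0Zp : left_id (natZp 0) addZp.
Proof. by move=> x; apply: zres_inj => n /=; rewrite mod0n add0n zres_mod. Qed.

Lemma addNZp : left_inverse (natZp 0) oppZp addZp.
Proof.
move=> x; apply: zres_inj => n /=.
by rewrite modnDml subnK ?(ltnW (zres_lt _ _)) // modnn mod0n.
Qed.

HB.instance Definition _ :=
  GRing.isZmodule.Build 'Zp[pr_p] addZpA addZpC add0Zp addNZp.

Lemma mulZpA : associative mulZp.
Proof.
by move=> x y z; apply: zres_inj => n /=; rewrite modnMmr modnMml mulnA.
Qed.

Lemma mulZpC : commutative mulZp.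
Proof. by move=> x y; apply: zres_inj => n /=; rewrite mulnC. Qed.

Lemma mul1Zp : left_id (natZp 1) mulZp.
Proof.
by move=> x; apply: zres_inj => n /=; rewrite modnMml mul1n zres_mod.
Qed.

Lemma mulZpDl : left_distributive mulZp addZp.
Proof.
move=> x y z; apply: zres_inj => n /=.
by rewrite modnMml modnDm mulnDl.
Qed.

Lemma oneZp_neq0 : natZp 1 != natZp 0.
Proof.
apply/eqP => /(congr1 (fun x => zres x 1)) /=.
by rewrite expn1 mod0n modn_small ?prime_gt1.
Qed.

HB.instance Definition _ := GRing.Zmodule_isComNzRing.Build 'Zp[pr_p]
  mulZpA mulZpC mul1Zp mulZpDl oneZp_neq0.

Local Open Scope ring_scope.

Definition unitZp : pred 'Zp[pr_p] := fun x => `[< exists y, y * x = 1 >].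
Definition invZp x : 'Zp[pr_p] := xget x [set y | y * x = 1]%classic.

Lemma mulVZp : {in unitZp, left_inverse 1 invZp *%R}.
Proof. by move=> x /asboolP; apply: xgetPex. Qed.

Lemma unitZpP x y : y * x = 1 -> unitZp x.
Proof. by move=> yx1; apply/asboolP; exists y. Qed.

Lemma invZp_out : {in [predC unitZp], invZp =1 id}.
Proof.
by move=> x /negP Nx; apply: xgetPN => y /unitZpP.
Qed.

HB.instance Definition _ := GRing.ComNzRing_hasMulInverse.Build 'Zp[pr_p]
  mulVZp unitZpP invZp_out.

Lemma zresD x y n : zres (x + y) n = ((zres x n + zres y n) %% p ^ n)%N.
Proof. by []. Qed.

Lemma zresM x y n : zres (x * y) n = ((zres x n * zres y n) %% p ^ n)%N.
Proof. by []. Qed.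

Lemma zresN x n : zres (- x) n = ((p ^ n - zres x n) %% p ^ n)%N.
Proof. by []. Qed.

Lemma zres0 n : zres (0 : 'Zp[pr_p]) n = 0%N.
Proof. exact: mod0n. Qed.

Lemma zres_nat k n : zres (k%:R : 'Zp[pr_p]) n = (k %% p ^ n)%N.
Proof.
elim: k => [|k IH]; first by rewrite zres0 mod0n.
by rewrite mulrSr zresD {}IH /= modnDm addn1.
Qed.

(* Congruence modulo p^n in Z_p. *)
Definition eqmodp n x y := exists c : 'Zp[pr_p], x - y = p%:R ^+ n * c.

(* The exact quotient by p of an element of p Z_p. *)
Lemma div_subproof x : coherent (fun n => zres x n.+1 %/ p)%N.
Proof.
move=> n; rewrite -(zres_coherent x n.+1) expnS.
by rewrite mulnC -modn_divl modn_mod.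
Qed.
Definition divp x := mkZp (div_subproof x).

Lemma divpK x : zres x 1 = 0%N -> p%:R * divp x = x.
Proof.
move=> x1; apply: zres_inj => n; rewrite zresM zres_nat /=.
rewrite modnMmr modnMml mulnC divnK.
  by rewrite zres_coherent.
have := zres_trunc x (ltn0Sn n).
by rewrite x1 expn1 => /eqP.
Qed.

Lemma eqmodpP n x y : eqmodp n x y <-> zres x n = zres y n.
Proof.
split=> [[c /eqP]|Exy].
  rewrite subr_eq => /eqP ->; rewrite zresD zresM -natrX zres_nat.
  by rewrite modnn mul0n mod0n add0n zres_mod.
suff H : forall m z, zres z m = 0%N -> exists c, z = p%:R ^+ m * c.
  apply: H; rewrite zresD zresN Exy modnDmr subnKC ?modnn //.
  exact/ltnW/zres_lt.
elim=> [|m IH] z z0; first by exists z; rewrite mul1r.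
have z1 : zres z 1 = 0%N by rewrite -(zres_trunc z (ltn0Sn m)) z0 mod0n.
have [|c Dc] := IH (divp z); last by exists c; rewrite exprS -mulrA -Dc divpK.
by rewrite /= z0 div0n mod0n.
Qed.

Lemma padic_unitE x : (x \is a GRing.unit) = ~~ (p %| zres x 1)%N.
Proof.
apply/idP/idP => [/mulVr/(congr1 (fun z => zres z 1)) | Nx].
  apply: contra_eqN => /eqP x1; rewrite zresM -modnMmr expn1 x1 muln0 mod0n.
  by rewrite (zres_nat 1) expn1 modn_small ?prime_gt1.
pose f n := (zres x n ^ (totient (p ^ n)).-1)%N.
have cop n m : (n > 0)%N -> coprime (zres x n) (p ^ m).
  move=> n0; rewrite coprime_sym; case: m => [|m]; first exact: coprime1n.
  rewrite coprime_pexpl // prime_coprime //; apply: contra Nx => px.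
  by rewrite -(zres_trunc x n0) expn1 (eqP px).
have fx n : (f n * zres x n = 1 %[mod p ^ n])%N.
  case: n => [|n]; first by rewrite !modn1.
  rewrite /f mulnC -expnS prednK ?totient_gt0 ?expp_gt0 //.
  by rewrite Euler_exp_totient ?cop.
have fcoh : coherent f.
  move=> n; apply/eqP; rewrite -[f n.+1]mul1n -[f n]mul1n.
  rewrite -modnMml -(fx n) modnMml.
  have E : (f n.+1 * zres x n = 1 %[mod p ^ n])%N.
    rewrite -modnMmr -(zres_coherent x n) modn_mod modnMmr.
    rewrite -(@modn_dvdm (p ^ n.+1)) ?dvdn_exp2l // fx modn_dvdm //.
    by rewrite dvdn_exp2l.
  rewrite -mulnA [(zres x n * _)%N]mulnC -modnMmr E modnMmr muln1.
  by rewrite mul1n.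
apply/unitrP; exists (mkZp fcoh); rewrite [x * _]mulrC; split;
  by apply: zres_inj => n; rewrite zresM /= modnMml fx.
Qed.

(* The p-adic limit of a convergent sequence (0 if the sequence diverges). *)
Definition cvgp (u : nat -> 'Zp[pr_p]) l :=
  forall n, exists N, forall m, (N <= m)%N -> eqmodp n (u m) l.
Definition limp u : 'Zp[pr_p] := xget 0 [set l | cvgp u l]%classic.

Lemma cvgp_unique u l l' : cvgp u l -> cvgp u l' -> l = l'.
Proof.
move=> ul ul'; apply: zres_inj => n.
have [[N HN] [N' HN']] := (ul n, ul' n).
have /eqmodpP <- := HN _ (leq_maxl N N').
by have /eqmodpP <- := HN' _ (leq_maxr N N').
Qed.

Lemma limpP u l : cvgp u l -> limp u = l.
Proof.
move=> ul; apply: (cvgp_unique _ ul).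
exact: (@xgetPex _ 0 [set l | cvgp u l]%classic (ex_intro _ l ul)).
Qed.

(* Morita's p-adic Gamma function: on the natural numbers, and at x as the
   limit along the natural numbers [zres x n], which tend to x. For p odd,
   [gammapP] and [gammap_continuous] show that this is the continuous
   extension. *)
Definition gammap_nat (n : nat) : 'Zp[pr_p] :=
  (-1) ^+ n * \prod_(1 <= k < n | ~~ (p %| k)%N) k%:R.

Definition gammap x : 'Zp[pr_p] := limp (fun n => gammap_nat (zres x n)).

Definition poch x k : 'Zp[pr_p] := \prod_(i < k) (x + i%:R).

(* The dash operation: the p-adic integer (x + <-x>_p) / p. *)
Definition dashp x := divp (x + (zres (- x) 1)%:R).

Lemma dashpK x : p%:R * dashp x = x + (zres (- x) 1)%:R.
Proof.
rewrite divpK // zresD zres_nat modnDmr zresN.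
by rewrite modnDmr subnKC ?modnn // ltnW ?zres_lt.
Qed.

End PadicRing.

Arguments eqmodp {p pr_p}.

Section GammaExtension.
Context (p : nat) (pr_p : prime p) (odd_p : odd p).
Local Open Scope ring_scope.

Lemma eqmodpr n (x : 'Zp[pr_p]) : eqmodp n x x.
Proof. exact/eqmodpP. Qed.

Lemma eqmodp0 (x y : 'Zp[pr_p]) : eqmodp 0 x y.
Proof. by exists (x - y); rewrite mul1r. Qed.

Lemma eqmodpM n (x y z t : 'Zp[pr_p]) :
  eqmodp n x y -> eqmodp n z t -> eqmodp n (x * z) (y * t).
Proof. by move=> /eqmodpP E1 /eqmodpP E2; apply/eqmodpP; rewrite !zresM E1 E2. Qed.

Lemma gammap_natS n : gammap_nat pr_p n.+1 =
  - (gammap_nat pr_p n * (if (p %| n)%N then 1 else n%:R)).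
Proof.
rewrite /gammap_nat exprS mulN1r !mulNr; congr (- _); rewrite -mulrA.
congr (_ * _); case: n => [|n].
  by rewrite !big_geq // dvdn0 mulr1.
rewrite big_mkcond big_nat_recr //= -big_mkcond /=.
by case: (p %| _)%N.
Qed.

Lemma sqr_eq1_Zpn n (u : 'Z_(p ^ n.+1)) : u * u = 1 -> (u == 1) || (u == -1).
Proof.
have pn1 : (1 < p ^ n.+1)%N by rewrite -(exp1n n.+1) ltn_exp2r ?prime_gt1.
have zE k : (k%:R == 0 :> 'Z_(p ^ n.+1)) = (p ^ n.+1 %| k)%N.
  by rewrite -val_eqE /= val_Zp_nat.
have := natr_Zp u; move: (val u) => k <- /eqP.
case: k => [|k]; first by rewrite mul0r eq_sym oner_eq0.
rewrite -addr_eq0 -(subr_eq0 _ 1) -[in (_ == 1) || _](subr_eq0 _ 1).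
have -> : k.+1%:R * k.+1%:R - 1 = (k * k.+2)%:R :> 'Z_(p ^ n.+1).
  by rewrite natrM -!natr1; ring.
have -> : k.+1%:R - 1 = k%:R :> 'Z_(p ^ n.+1) by rewrite -natr1 addrK.
rewrite natr1 !zE => pnk; apply/orP.
have [pk|pk] := boolP (p %| k)%N; [left|right; move: pnk]; last first.
  by rewrite Gauss_dvdr // coprime_pexpl // prime_coprime.
rewrite -(@Gauss_dvdl _ _ k.+2) // coprime_pexpl // prime_coprime //.
rewrite -addn2 dvdn_addr // dvdn_prime2 //.
by apply: contraTN odd_p => /eqP ->.
Qed.

Lemma prod_coprime_modp n :
  \prod_(1 <= k < p ^ n.+1 | ~~ (p %| k)%N) k%:R = -1 :> 'Z_(p ^ n.+1).
Proof.
have pn1 : (1 < p ^ n.+1)%N by rewrite -(exp1n n.+1) ltn_exp2r ?prime_gt1.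
have n11 : 1 != -1 :> 'Z_(p ^ n.+1).
  have := val_Zp_nat pn1 2; rewrite -addr_eq0 -val_eqE /= => ->.
  apply/negP => /(dvdn_trans (dvdn_exp (ltn0Sn n) (dvdnn p))).
  by rewrite dvdn_prime2 //; apply/negP; apply: contraTN odd_p => /eqP ->.
transitivity (\prod_(u : 'Z_(p ^ n.+1) | u \is a GRing.unit) u).
  rewrite [RHS](eq_bigr (fun u : 'Z__ => (val u)%:R)); last first.
    by move=> u _; rewrite natr_Zp.
  rewrite [RHS](eq_bigl (fun u : 'Z__ => ~~ (p %| val u)%N)); last first.
    move=> u; rewrite -{1}(natr_Zp u) unitZpE // coprime_pexpl //.
    by rewrite prime_coprime.
  rewrite -(big_mkord (fun k => ~~ (p %| k)%N) (fun k => k%:R)).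
  rewrite [X in \prod_(0 <= _ < X | _) _]Zp_cast //.
  by rewrite [in RHS]big_ltn_cond ?expn_gt0 ?prime_gt0 // dvdn0.
rewrite (bigID (fun u => u * u == 1)) /= [X in _ * X](_ : _ = 1) ?mulr1.
  rewrite (bigD1 1) ?unitr1 ?mulr1 //= mul1r (bigD1 (-1)) /=; last first.
    by rewrite unitrN1 mulrNN mulr1 eqxx eq_sym.
  rewrite big1 ?mulr1 // => u /andP[/andP[/andP[_ /eqP/sqr_eq1_Zpn]]].
  by case/orP => ->.
pose r (u : 'Z_(p ^ n.+1)) := (val u < val u^-1)%N.
rewrite (bigID r) /= [X in _ * X](reindex_inj (@invr_inj _)) /=.
rewrite [X in _ * X](eq_bigl (fun u =>
  [&& u \is a GRing.unit, u * u != 1 & r u])); last first.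
  move=> u; rewrite unitrV /r invrK.
  case uU: (u \is a GRing.unit) => //=.
  have -> : (u^-1 * u^-1 == 1) = (u * u == 1).
    by rewrite -invrM // invr_eq1.
  case: eqP => //= Nu; rewrite -leqNgt ltn_neqAle andbC.
  case: leqP => //= _; rewrite eq_sym; apply/esym/eqP => /val_inj E.
  by apply: Nu; rewrite -{1}E mulVr.
rewrite [X in X * _](eq_bigl (fun u =>
  [&& u \is a GRing.unit, u * u != 1 & r u])); last by move=> u; rewrite andbA.
by rewrite -big_split big1 //= => u /and3P[uU _ _]; rewrite mulrV.
Qed.

Lemma gammap_nat_pX n : eqmodp n (gammap_nat pr_p (p ^ n)) 1.
Proof.
case: n => [|n]; first exact: eqmodp0.
have pn1 : (1 < p ^ n.+1)%N by rewrite -(exp1n n.+1) ltn_exp2r ?prime_gt1.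
rewrite /gammap_nat -signr_odd oddX odd_p /= expr1 mulN1r -natr_prod.
have := prod_coprime_modp n; rewrite -natr_prod => /eqP.
rewrite -addr_eq0 natr1 -val_eqE /= val_Zp_nat // => /dvdnP[c Dc].
exists (- c%:R); rewrite mulrN -natrX -natrM mulnC -Dc -natr1; ring.
Qed.

Lemma gammap_nat_period n m :
  eqmodp n (gammap_nat pr_p (m + p ^ n)) (gammap_nat pr_p m).
Proof.
case: n => [|n]; first exact: eqmodp0.
elim: m => [|m IH].
  rewrite add0n {2}/gammap_nat mul1r big_geq //; exact: gammap_nat_pX.
rewrite addSn !gammap_natS -[- _]mulN1r -[X in eqmodp _ _ X]mulN1r.
apply/eqmodpM/eqmodpM => //; first exact: eqmodpr.
rewrite dvdn_addl ?dvdn_exp //; case: ifP => _; first exact: eqmodpr.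
by exists 1; rewrite mulr1 natrD natrX; ring.
Qed.

Lemma gammap_nat_cong n a b : a = b %[mod p ^ n] ->
  eqmodp n (gammap_nat pr_p a) (gammap_nat pr_p b).
Proof.
have H k m : eqmodp n (gammap_nat pr_p (m + k * p ^ n)) (gammap_nat pr_p m).
  elim: k => [|k /eqmodpP IH]; first by rewrite addn0; apply: eqmodpr.
  apply/eqmodpP; rewrite -IH mulSnr addnA.
  exact/eqmodpP/gammap_nat_period.
move=> ab; apply/eqmodpP.
have /eqmodpP := H (a %/ p ^ n)%N (a %% p ^ n)%N.
have /eqmodpP := H (b %/ p ^ n)%N (b %% p ^ n)%N.
by rewrite ![(_ %% _ + _)%N]addnC -!divn_eq ab => -> ->.
Qed.

Lemma gammap_cvg x : cvgp (fun n => gammap_nat pr_p (zres x n)) (gammap x).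
Proof.
have fcoh : @coherent p (fun n => zres (gammap_nat pr_p (zres x n)) n).
  move=> n; rewrite zres_coherent zres_mod; apply/eqmodpP/gammap_nat_cong.
  by rewrite zres_coherent zres_mod.
suff fx : cvgp (fun n => gammap_nat pr_p (zres x n)) (mkZp pr_p fcoh).
  by rewrite /gammap (limpP fx).
move=> n; exists n => m le_nm; apply/eqmodpP; rewrite [RHS]zres_mod.
by apply/eqmodpP/gammap_nat_cong; rewrite (zres_trunc x le_nm) zres_mod.
Qed.

Lemma gammap_mod x n : eqmodp n (gammap x) (gammap_nat pr_p (zres x n)).
Proof.
have [N HN] := gammap_cvg x n; apply/eqmodpP.
have /eqmodpP <- := HN _ (leq_maxl N n).
apply/eqmodpP/gammap_nat_cong.
by rewrite zres_trunc ?leq_maxr // zres_mod.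
Qed.

Lemma gammapP k : gammap k%:R = gammap_nat pr_p k.
Proof.
apply: zres_inj => n; have /eqmodpP -> := gammap_mod k%:R n.
by apply/eqmodpP/gammap_nat_cong; rewrite zres_nat modn_mod.
Qed.

Lemma gammap_continuous n (x y : 'Zp[pr_p]) :
  eqmodp n x y -> eqmodp n (gammap x) (gammap y).
Proof.
move=> /eqmodpP Exy; apply/eqmodpP.
by have [/eqmodpP -> /eqmodpP ->] := (gammap_mod x n, gammap_mod y n); rewrite Exy.
Qed.

Lemma gammap_unit (x : 'Zp[pr_p]) : gammap x \is a GRing.unit.
Proof.
rewrite padic_unitE; have /eqmodpP -> := gammap_mod x 1.
rewrite -padic_unitE /gammap_nat unitrMr ?unitrX ?unitrN1 //.
elim/big_ind: _ => [|a b ua ub|k Nk]; first exact: unitr1.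
  by rewrite unitrM ua.
by rewrite padic_unitE zres_nat expn1 /dvdn modn_mod.
Qed.

End GammaExtension.

(* Main.v *)
From HB Require Import structures.
Require Import Defs.
From mathcomp Require Import all_boot all_order all_algebra.
From mathcomp Require Import finfield ring zify.

Import GRing.Theory.
Local Open Scope ring_scope.

Set Implicit Arguments.
Unset Strict Implicit.
Unset Printing Implicit Defensive.

(* Let [n = (p-1)/2], [N(w) = \prod_(j < n) (2j+1-w)], and write [F(x)] for the
   truncated sum, a polynomial in [x], and [T(x)] for the Gamma quotient. At
   [x = -a] both satisfy [(a+2)^2 f(-a-2) = (a+1)^2 f(-a)], so for [a < p] we
   get [F(-a) = T(-a)] if [a] is even and [F(-a) = 0] if [a] is odd; the
   symmetry [x -> 1-x] gives the same at [x = -a+p]. Modulo [p], [F] has degree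
   less than [p], hence is determined by these values: it is [(N(-x)/N(0))^2].
   Finally, a polynomial which vanishes modulo [p], and modulo [p^3] at [0] and
   at [-p], vanishes modulo [p^3] on all of [p Z_p].
   For [a] even this applies to the difference of [F(-a-z)] and the rational
   function of [z] that is congruent to [T(-a-z)] modulo [p^3] on [p Z_p],
   denominators cleared; the latter congruence amounts to
   [Gamma_p(pu) Gamma_p(pv) = Gamma_p(p(u+v))] modulo [p^3], which follows from
   Wolstenholme's theorem and needs [p > 3].
   For [a] odd, [F(-a-z) = z(z+p) k(z)], and only [k(0)] and [T(-a)] modulo [p]
   matter. *)

(** * Products over arithmetic progressions *)

Section Generic.
Variable A : comNzRingType.
Implicit Types x w z : A.

Definition rising x k : A := \prod_(i < k) (x + i%:R).
Definition oddprod n w : A := \prod_(j < n) (j.*2.+1%:R - w).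
(** The squared quotient of [oddshift b z] by [evenshift b z] is the factor that [b] steps of the
    recurrence produce between [-z] and [-2b - z]. *)
Definition evenshift b z : A := \prod_(j < b) (j.*2.+2%:R + z).
Definition oddshift b z : A := \prod_(j < b) (j.*2.+1%:R + z).

Lemma risingS x k : rising x k.+1 = rising x k * (x + k%:R).
Proof. exact: big_ord_recr. Qed.

Lemma rising_eq0 a k : (a < k)%N -> rising (- a%:R) k = 0.
Proof.
by move=> ak; rewrite /rising (bigD1 (Ordinal ak)) //= addNr mul0r.
Qed.

(** Both sides are [rising x k.+2], with two factors split off at the top or at the bottom. *)
Lemma rising_shift2 x k :
  rising x k * ((x + k%:R) * (x + 1 + k%:R)) =
  x * (x + 1) * rising (x + 2%:R) k.
Proof.
elim: k => [|k IH]; first by rewrite /rising !big_ord0 !addr0 mul1r mulr1.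
rewrite !risingS -[k.+1%:R]natr1 [RHS]mulrA -{}IH; ring.
Qed.

(** Moving [w] by 2 shifts the progression by one place: the factor [-1 - w] enters and [2n - 1 - w]
    leaves. *)
Lemma oddprod_shift2 n w :
  oddprod n (w + 2%:R) * (n.*2%:R - 1 - w) = oddprod n w * (- 1 - w).
Proof.
case: n => [|n]; first by rewrite /oddprod !big_ord0 sub0r.
rewrite /oddprod big_ord_recl [X in _ = X * _]big_ord_recr /=.
rewrite (eq_bigr (fun j : 'I_n => j.*2.+1%:R - w)); last first.
  by move=> j _; rewrite /bump /= doubleS -[j.*2.+3]addn2 natrD; ring.
by rewrite doubleS double0; ring.
Qed.

Lemma evenshiftS b z : evenshift b.+1 z = evenshift b z * (b.*2.+2%:R + z).
Proof. exact: big_ord_recr. Qed.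

Lemma oddshiftS b z : oddshift b.+1 z = oddshift b z * (b.*2.+1%:R + z).
Proof. exact: big_ord_recr. Qed.

End Generic.

Lemma size_prod_linear (R : nzRingType) k (f : nat -> {poly R}) :
  (forall i, (size (f i) <= 2)%N) -> (size (\prod_(i < k) f i)%R <= k.+1)%N.
Proof.
move=> f2; elim: k => [|k IH]; first by rewrite big_ord0 size_poly1.
rewrite big_ord_recr /=; apply: leq_trans (size_polyMleq _ _) _.
rewrite -subn1 leq_subLR (leq_trans (leq_add IH (f2 k))) //; lia.
Qed.

Lemma size_linear (R : nzRingType) (f : {poly R}) a :
  (size f <= 2)%N -> (size (f + a%:R)%R <= 2)%N.
Proof.
move=> f2; rewrite (leq_trans (size_polyD _ _)) // geq_max f2 -polyC_natr.
exact: leq_trans (size_polyC_leq1 _) _.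
Qed.

Lemma size_rising (R : comNzRingType) (f : {poly R}) k :
  (size f <= 2)%N -> (size (rising f k) <= k.+1)%N.
Proof.
move=> f2; apply: (@size_prod_linear _ _ (fun j => f + j%:R)) => j.
exact: size_linear.
Qed.

Section Morphism.
Variables (A B : comNzRingType) (f : {rmorphism A -> B}).

Lemma rmorph_rising x k : f (rising x k) = rising (f x) k.
Proof. by rewrite rmorph_prod; apply: eq_bigr => i _; rewrite rmorphD rmorph_nat. Qed.

Lemma rmorph_oddprod n w : f (oddprod n w) = oddprod n (f w).
Proof. by rewrite rmorph_prod; apply: eq_bigr => i _; rewrite rmorphB rmorph_nat. Qed.

Lemma rmorph_evenshift b z : f (evenshift b z) = evenshift b (f z).
Proof. by rewrite rmorph_prod; apply: eq_bigr => i _; rewrite rmorphD rmorph_nat. Qed.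

Lemma rmorph_oddshift b z : f (oddshift b z) = oddshift b (f z).
Proof. by rewrite rmorph_prod; apply: eq_bigr => i _; rewrite rmorphD rmorph_nat. Qed.

End Morphism.

Section Horner.
Variables (A : comNzRingType) (f : {poly A}) (x : A).

Lemma horner_rising k : (rising f k).[x] = rising f.[x] k.
Proof. by rewrite -horner_evalE rmorph_rising. Qed.

Lemma horner_oddprod n : (oddprod n f).[x] = oddprod n f.[x].
Proof. by rewrite -horner_evalE rmorph_oddprod. Qed.

Lemma horner_evenshift b : (evenshift b f).[x] = evenshift b f.[x].
Proof. by rewrite -horner_evalE rmorph_evenshift. Qed.

Lemma horner_oddshift b : (oddshift b f).[x] = oddshift b f.[x].
Proof. by rewrite -horner_evalE rmorph_oddshift. Qed.

End Horner.

(** * Reduction modulo [p] *)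

Section Reduction.
Context (p : nat) (pr_p : prime p).
Local Notation Zp := 'Zp[pr_p].
Implicit Types x y : Zp.

Definition reduce x : 'F_p := (zres x 1)%:R.

Fact red_is_nmod_morphism : nmod_morphism reduce.
Proof.
split=> [|x y]; first by rewrite /reduce zres0.
by rewrite /reduce zresD expn1 Fp_nat_mod // natrD.
Qed.

Fact red_is_monoid_morphism : monoid_morphism reduce.
Proof.
split=> [|x y]; last by rewrite /reduce zresM expn1 Fp_nat_mod // natrM.
by rewrite /reduce (zres_nat pr_p 1) expn1 Fp_nat_mod.
Qed.

HB.instance Definition _ := GRing.isNmodMorphism.Build Zp 'F_p reduce
  red_is_nmod_morphism.
HB.instance Definition _ := GRing.isMonoidMorphism.Build Zp 'F_p reduce
  red_is_monoid_morphism.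

Lemma natFp_eq0 k : (k%:R == 0 :> 'F_p) = (p %| k)%N.
Proof. by rewrite (dvdn_pcharf (pchar_Fp pr_p)). Qed.

Lemma natFp_p : p%:R = 0 :> 'F_p.
Proof. by apply/eqP; rewrite natFp_eq0. Qed.

Lemma red_unit x : (x \is a GRing.unit) = (reduce x != 0).
Proof. by rewrite padic_unitE natFp_eq0. Qed.

Lemma red_eq0 x : reduce x = 0 <-> exists c, x = p%:R * c.
Proof.
split=> [/eqP|[c ->]]; last by rewrite rmorphM rmorph_nat natFp_p mul0r.
rewrite natFp_eq0 => /dvdnP[c Dc].
have := zres_lt x 1; rewrite expn1 Dc -{2}[p]mul1n ltn_pmul2r ?prime_gt0 //.
rewrite ltnS leqn0 => /eqP c0; exists (Defs.divp x).
by rewrite Defs.divpK // Dc c0.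
Qed.

Lemma nat_unit k : (k%:R \is a @GRing.unit Zp) = ~~ (p %| k)%N.
Proof. by rewrite red_unit rmorph_nat natFp_eq0. Qed.

Lemma lt_nat_unit k : (0 < k < p)%N -> k%:R \is a @GRing.unit Zp.
Proof. by move=> /andP[k0 kp]; rewrite nat_unit gtnNdvd. Qed.

Lemma fact_unit k : (k < p)%N -> (k`!)%:R \is a @GRing.unit Zp.
Proof.
elim: k => [|k IH] kp; first by rewrite unitr1.
by rewrite factS natrM unitrM IH ?(ltnW kp) // lt_nat_unit.
Qed.

(** The residue of [p * x] modulo [p^(n+1)] is [p] times the residue of [x] modulo [p^n], so [Z_p]
    has no [p]-torsion. *)
Lemma mulpI : injective (fun x => p%:R * x).
Proof.
suff H x : p%:R * x = 0 -> x = 0.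
  by move=> x y /eqP; rewrite -subr_eq0 -mulrBr => /eqP/H/eqP; rewrite subr_eq0 => /eqP.
move=> px0; apply: zres_inj => n.
have : zres (p%:R * x) n.+1 = 0%N by rewrite px0 zres0.
rewrite zres0 zresM zres_nat modnMml expnS -muln_modr zres_coherent.
by move/eqP; rewrite muln_eq0 (gtn_eqF (prime_gt0 pr_p)) => /eqP.
Qed.

Lemma eqmodp_sym n x y : eqmodp n x y -> eqmodp n y x.
Proof. by move=> /eqmodpP E; apply/eqmodpP. Qed.

Lemma eqmodp_trans n y x z : eqmodp n x y -> eqmodp n y z -> eqmodp n x z.
Proof. by move=> /eqmodpP E1 /eqmodpP E2; apply/eqmodpP; rewrite E1. Qed.

Lemma eqmodpX n x y k : eqmodp n x y -> eqmodp n (x ^+ k) (y ^+ k).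
Proof.
move=> xy; elim: k => [|k IH]; first exact: eqmodpr.
by rewrite !exprS; apply: eqmodpM.
Qed.

Lemma eqmodp_mulI n u x y : u \is a GRing.unit ->
  eqmodp n (u * x) (u * y) -> eqmodp n x y.
Proof.
move=> uU [c Dc]; exists (u^-1 * c).
by apply: (mulrI uU); rewrite mulrBr Dc mulrCA mulVKr.
Qed.

Lemma eqmodp1_red x y : reduce x = reduce y -> eqmodp 1 x y.
Proof.
by move=> E; apply/red_eq0; rewrite rmorphB /= E subrr.
Qed.

Lemma poly_red_eq0 (h : {poly Zp}) :
  map_poly reduce h = 0 -> exists k, h = p%:R *: k.
Proof.
move=> h0; exists (\poly_(i < size h) Defs.divp h`_i).
apply/polyP => i; rewrite coefZ coef_poly.
case: ltnP => [_|hi]; last by rewrite mulr0 nth_default.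
have /red_eq0[c Dc] : reduce h`_i = 0 by rewrite -coef_map h0 coef0.
rewrite Defs.divpK // Dc zresM zres_nat expn1 modnn mul0n mod0n //.
Qed.

Lemma horner_red (h : {poly Zp}) x : reduce h.[x] = (map_poly reduce h).[reduce x].
Proof. by rewrite horner_map. Qed.

Lemma factor0 (h : {poly Zp}) : h.[0] = 0 -> exists k, h = k * 'X.
Proof. by move=> /eqP/factor_theorem[k ->]; exists k; rewrite subr0. Qed.

Lemma factor0p (h : {poly Zp}) : h.[0] = 0 -> h.[- p%:R] = 0 ->
  exists k, h = k * ('X * ('X + p%:R%:P)).
Proof.
move=> /factor0[k ->]; rewrite hornerMX mulrN mulrC => /eqP.
rewrite oppr_eq0 => /eqP; rewrite -[RHS](mulr0 p%:R) => /mulpI/eqP/factor_theorem[g ->].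
by exists g; rewrite polyCN opprK -mulrA [_ * 'X]mulrC.
Qed.

(** Write [h = p g X]. Then [h(-p) = -p^2 g(-p)] forces [p] to divide [g(-p)], hence also [g(pt)],
    because both arguments reduce to 0; and [h(pt) = p^2 t g(pt)]. *)
Lemma vanish_modp3 (h : {poly Zp}) t :
  map_poly reduce h = 0 -> h.[0] = 0 -> eqmodp 3 h.[- p%:R] 0 ->
  eqmodp 3 h.[p%:R * t] 0.
Proof.
move=> h0 /factor0[k Dh].
have /poly_red_eq0[g Dg] : map_poly reduce k = 0.
  by apply/eqP; move/eqP: h0; rewrite Dh rmorphM /= map_polyX mulf_eq0 polyX_eq0 orbF.
rewrite {}Dh {}Dg => -[c]; rewrite !hornerMX !hornerZ subr0.
have -> : p%:R * g.[- p%:R] * - p%:R = p%:R * (p%:R * - g.[- p%:R]) by ring.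
have -> : p%:R ^+ 3 * c = p%:R * (p%:R * (p%:R * c)) by ring.
move=> /mulpI/mulpI gp.
have /red_eq0[d Dd] : reduce g.[p%:R * t] = 0.
  rewrite horner_red rmorphM rmorph_nat natFp_p mul0r.
  have : reduce (- g.[- p%:R]) = 0 by apply/red_eq0; exists c.
  by rewrite rmorphN /= horner_red rmorphN /= rmorph_nat natFp_p oppr0 => /eqP;
     rewrite oppr_eq0 => /eqP.
by exists (t * d); rewrite subr0 Dd; ring.
Qed.

(** The points [-a] with [a < p] exhaust [F_p], so a nonzero difference would have more roots than
    its degree allows. *)
Lemma poly_Fp_ext (f g : {poly 'F_p}) : (size f <= p)%N -> (size g <= p)%N ->
  (forall a, (a < p)%N -> f.[- a%:R] = g.[- a%:R]) -> f = g.
Proof.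
move=> fp gp fg; apply/eqP; rewrite -subr_eq0; apply/negPn/negP => Nfg.
have rts : all (root (f - g)) (enum 'F_p).
  apply/allP => x _; rewrite rootE hornerD hornerN subr_eq0; apply/eqP.
  rewrite -[x]opprK -(natr_Zp (- x)); apply: fg.
  by rewrite -[X in (_ < X)%N](Fp_cast pr_p).
have := max_poly_roots Nfg rts (enum_uniq 'F_p).
rewrite -cardE card_Fp // ltnNge (leq_trans (size_polyD _ _)) //.
by rewrite size_polyN geq_max fp gp.
Qed.

End Reduction.

(** * The truncated hypergeometric sum *)

Section TruncatedSum.
Context (p : nat) (pr_p : prime p) (odd_p : odd p).
Local Notation Zp := 'Zp[pr_p].
Local Notation half := (2%:R^-1 : Zp).
Local Notation red := (@reduce p pr_p).

Lemma odd_half_doubleS : p = p./2.*2.+1.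
Proof. by rewrite -[LHS]odd_double_half odd_p. Qed.

Lemma natr_half (A : nzRingType) : p%:R = 2%:R * p./2%:R + 1 :> A.
Proof. by rewrite [in LHS]odd_half_doubleS -natr1 -mul2n natrM. Qed.

Lemma unit2 : 2%:R \is a @GRing.unit Zp.
Proof. by rewrite lt_nat_unit // (odd_prime_gt2 odd_p pr_p). Qed.

Lemma mul2half : 2%:R * half = 1.
Proof. by rewrite mulrV ?unit2. Qed.

Definition trunc_sum (x : Zp) : Zp :=
  \sum_(k < p) poch x k * poch (1 - x) k * poch half k / (k`!)%:R ^+ 3.

Definition trunc_sumX : {poly Zp} :=
  \sum_(k < p) (poch half k / (k`!)%:R ^+ 3) *: (rising 'X k * rising (1 - 'X) k).

Lemma horner_trunc_sum x : trunc_sumX.[x] = trunc_sum x.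
Proof.
rewrite horner_sum; apply: eq_bigr => k _.
have E : (1 - 'X).[x] = 1 - x by rewrite !hornerE.
by rewrite hornerZ hornerM !horner_rising hornerX E mulrC mulrA.
Qed.

Lemma pochS (x : Zp) k : poch x k.+1 = poch x k * (x + k%:R).
Proof. exact: big_ord_recr. Qed.

Lemma trunc_sumC x : trunc_sum (1 - x) = trunc_sum x.
Proof.
by apply: eq_bigr => k _; rewrite subKr [poch (1 - x) k * _]mulrC.
Qed.

Lemma trunc_sum_split (x : Zp) m : (m <= p)%N ->
  (forall k, (m <= k)%N -> poch x k * poch (1 - x) k = 0) ->
  trunc_sum x =
    \sum_(k < m) poch x k * poch (1 - x) k * poch half k / (k`!)%:R ^+ 3.
Proof.
move=> mp x0; rewrite /trunc_sum -!(big_mkord xpredT (fun k =>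
  poch x k * poch (1 - x) k * poch half k / (k`!)%:R ^+ 3)).
rewrite (big_cat_nat (leq0n m) mp) /= [X in _ + X]big_nat_cond [X in _ + X]big1 ?addr0 //.
by move=> k /andP[/andP[mk _] _]; rewrite x0 // !mul0r.
Qed.

Lemma trunc_sum0 : trunc_sum 0 = 1.
Proof.
rewrite (@trunc_sum_split _ 1) ?prime_gt0 // => [|k k0].
  by rewrite big_ord1 /poch /= !big_ord0 !mul1r expr1n invr1.
by rewrite -[X in poch X k]oppr0 [poch _ k](@rising_eq0 Zp 0) // mul0r.
Qed.

Lemma trunc_sumN1 : trunc_sum (-1) = 0.
Proof.
rewrite (@trunc_sum_split _ 2) ?(ltnW (odd_prime_gt2 odd_p pr_p)) // => [|k k0].
  rewrite !big_ord_recl big_ord0 /poch !big_ord1 !big_ord0 /= !mulr1.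
  rewrite expr1n invr1 !addr0 mulr1.
  (* Only the terms [k = 0] and [k = 1] survive: 1 and [(-1) * 2 * half]. *)
  by transitivity (1 - 2%:R * half); [ring | rewrite mul2half subrr].
by rewrite [poch (-1) k](@rising_eq0 Zp 1) // mul0r.
Qed.

(* Zeilberger's certificate for the recurrence in [a = - x]; the right-hand
   side vanishes at [m = p - 1]. *)
Lemma trunc_sum_telescope (x : Zp) m : (m < p)%N ->
  (1 - x) * (2%:R - x) *
    \sum_(k < m.+1) ((2%:R - x) ^+ 2 * (poch (x - 2%:R) k * poch (3%:R - x) k)
      - (1 - x) ^+ 2 * (poch x k * poch (1 - x) k)) * (poch half k / (k`!)%:R ^+ 3)
  = (4%:R * x - 6%:R) * (poch (x - 2%:R) m.+1 * poch (1 - x) m.+1 *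
      poch half m.+1 / (m`!)%:R ^+ 3).
Proof.
elim: m => [_|m IH mp].
  rewrite big_ord1 /poch !big_ord1 !big_ord0 fact0 expr1n invr1 !addr0 !mulr1.
  transitivity (2%:R * half * (2%:R * x - 3%:R) * (x - 2%:R) * (1 - x)); last by ring.
  by rewrite mul2half; ring.
rewrite big_ord_recr [_ * (_ + _)]mulrDr IH ?(ltnW mp) //.
have Ex := rising_shift2 (x - 2%:R) m.+1; rewrite subrK in Ex.
have Ey := rising_shift2 (1 - x) m.+1.
have Dy : 1 - x + 2%:R = 3%:R - x by ring.
rewrite {}Dy in Ey.
set I := ((m.+1)`!%:R)^-1 : Zp.
have Im : (m`!)%:R^-1 = m.+1%:R * I.
  have mU := @fact_unit p pr_p m.+1 mp.
  have mU' := @fact_unit p pr_p m (ltnW mp).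
  apply: (mulrI mU'); rewrite mulrV // mulrCA mulrA -natrM -factS divrr //.
rewrite /= -!exprVn Im -/I (pochS _ m.+1) (pochS (1 - x) m.+1) (pochS half m.+1).
rewrite -[rising _ _]/(poch (x - 2%:R) m.+1) -[rising _ _]/(poch x m.+1) in Ex.
rewrite -[rising _ _]/(poch (1 - x) m.+1) -[rising _ _]/(poch (3%:R - x) m.+1) in Ey.
move: (poch (x - 2%:R) m.+1) (poch x m.+1) Ex => A D Ex.
move: (poch (1 - x) m.+1) (poch (3%:R - x) m.+1) Ey => B C Ey.
move: (poch half m.+1) (m.+1%:R) Ex Ey => P k Ex Ey.
(* The prefactor [(1 - x)(2 - x)] is regrouped so that [Ex] and [Ey] eliminate [D] and [C] in favour
   of [A] and [B]. *)
transitivity ((4%:R * x - 6%:R) * (A * B * P * (k * I) ^+ 3) +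
  ((2%:R - x) ^+ 2 * A * ((1 - x) * (1 - x + 1) * C) -
   (1 - x) ^+ 2 * B * ((x - 2%:R) * (x - 2%:R + 1) * D)) * (P * I ^+ 3)); first ring.
rewrite -Ex -Ey.
(* For [ring], [half] is an atom; its occurrences are collected as [2 * half] and then replaced by
   1. *)
transitivity ((A * (x - 2%:R + k) * (B * (1 - x + k)) * (P * I ^+ 3)) *
   (2%:R * half * (2%:R * x - 3%:R) + (4%:R * x - 6%:R) * k)); last ring.
rewrite mul2half; ring.
Qed.

Lemma trunc_sum_rec a : (a.+2 < p)%N ->
  a.+2%:R ^+ 2 * trunc_sum (- a.+2%:R) = a.+1%:R ^+ 2 * trunc_sum (- a%:R).
Proof.
move=> ap; have p1 : (p.-1 < p)%N by rewrite ltn_predL prime_gt0.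
have := @trunc_sum_telescope (- a%:R) p.-1 p1.
have U1 := @lt_nat_unit p pr_p a.+1 (ltnW ap).
have U2 := @lt_nat_unit p pr_p a.+2 ap.
have -> : - a%:R - 2%:R = - a.+2%:R :> Zp by ring.
have -> : 1 - - a%:R = a.+1%:R :> Zp by ring.
have -> : 2%:R - - a%:R = a.+2%:R :> Zp by ring.
have -> : 3%:R - - a%:R = 1 - - a.+2%:R :> Zp by ring.
(* The boundary term contains the factor [-(a+2) + (a+2)], since [a + 2 < p]. *)
rewrite prednK ?prime_gt0 // [poch (- a.+2%:R) p](@rising_eq0 Zp a.+2) //.
rewrite !mul0r mulr0 -[RHS](mulr0 (a.+1%:R * a.+2%:R)).
have U : a.+1%:R * a.+2%:R \is a @GRing.unit Zp by rewrite unitrM U1.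
move/(mulrI U) => E; apply/eqP; rewrite -subr_eq0 -{}E /trunc_sum !mulr_sumr.
rewrite -sumrB; apply/eqP/eq_bigr => k _.
by have -> : 1 - - a%:R = a.+1%:R :> Zp; ring.
Qed.

Lemma trunc_sum_odd a : odd a -> (a < p)%N -> trunc_sum (- a%:R) = 0.
Proof.
move=> oa; rewrite -(odd_double_half a) oa add1n; elim: a./2 => [|b IH].
  by move=> _; rewrite double0 trunc_sumN1.
rewrite doubleS => bp; have U := @lt_nat_unit p pr_p b.*2.+3 bp.
have U2 : b.*2.+3%:R ^+ 2 \is a @GRing.unit Zp by rewrite unitrX.
by apply: (mulrI U2); rewrite trunc_sum_rec // IH ?mulr0 // ltnW // ltnW.
Qed.

End TruncatedSum.

(** * The truncated sum modulo [p] *)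

Section ModP.
Context (p : nat) (pr_p : prime p) (odd_p : odd p).
Local Notation Zp := 'Zp[pr_p].
Local Notation half := (2%:R^-1 : Zp).
Local Notation red := (@reduce p pr_p).
Local Notation n := p./2.

(** Where [p = 0] one has [2n = -1], so the leaving factor of [oddprod_shift2] is [-(w + 2)].
    Squared, this is the recurrence of the truncated sum. It is used both in [F_p] and in
    [F_p[X]]. *)
Lemma oddprod_rec (A : comNzRingType) (w : A) : p%:R = 0 :> A ->
  oddprod n (w + 2%:R) * (w + 2%:R) = oddprod n w * (w + 1).
Proof.
move=> p0; have := oddprod_shift2 n w.
have : n.*2%:R + 1 = 0 :> A by rewrite natr1 -odd_half_doubleS.
move/eqP; rewrite addr_eq0 => /eqP -> E.
apply: oppr_inj; transitivity (oddprod n (w + 2%:R) * (- 1 - 1 - w)); first ring.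
by rewrite E; ring.
Qed.

Lemma oddprod_evenshift (A : comNzRingType) b (w : A) : p%:R = 0 :> A ->
  oddprod n (w + b.*2%:R) * evenshift b w = oddprod n w * oddshift b w.
Proof.
move=> p0; elim: b => [|b IH].
  by rewrite /evenshift /oddshift !big_ord0 addr0.
rewrite evenshiftS oddshiftS [RHS]mulrA -IH.
transitivity (oddprod n (w + b.*2%:R + 2%:R) * (w + b.*2%:R + 2%:R) * evenshift b w).
  by rewrite doubleS (_ : w + b.*2.+2%:R = w + b.*2%:R + 2%:R); ring.
by rewrite oddprod_rec //; ring.
Qed.

Lemma oddprod_unit : oddprod n 0 \is a @GRing.unit Zp.
Proof.
rewrite red_unit rmorph_prod; apply/prodf_neq0 => j _.
rewrite subr0 rmorph_nat natFp_eq0 // gtnNdvd //.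
by have := ltn_ord j; have := odd_half_doubleS odd_p; lia.
Qed.

Lemma red_trunc_sumX :
  map_poly red (trunc_sumX pr_p) = \sum_(k < p)
    red (poch half k / (k`!)%:R ^+ 3) *: (rising 'X k * rising (1 - 'X) k).
Proof.
rewrite rmorph_sum; apply: eq_bigr => k _.
rewrite /= map_polyZ; congr (_ *: _).
rewrite rmorphM !rmorph_rising rmorphB rmorph1 /= map_polyX //.
Qed.

(** The terms with [k > n] vanish modulo [p], and the others have degree at most [2n = p - 1]. *)
Lemma size_red_trunc_sumX : (size (map_poly red (trunc_sumX pr_p)) <= p)%N.
Proof.
have X2 : (size ('X : {poly 'F_p}) <= 2)%N by rewrite size_polyX.
have NX2 : (size (1 - 'X : {poly 'F_p})%R <= 2)%N.
  by rewrite addrC (@size_linear _ _ 1%N) // size_polyN size_polyX.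
rewrite red_trunc_sumX; apply: (leq_trans (size_sum _ _ _)).
apply/bigmax_leqP => k _; have [kn|nk] := leqP k n; last first.
  (* the factor [half + n] of [poch half k] is [p / 2] *)
  rewrite [poch _ _](bigD1 (Ordinal nk)) //= [half + _](_ : _ = p%:R * half).
    by rewrite !rmorphM rmorph_nat natFp_p // !mul0r scale0r size_poly0.
  rewrite (natr_half odd_p); transitivity (half + 2%:R * half * n%:R); last by ring.
  by rewrite mul2half ?mul1r.
apply: leq_trans (size_scale_leq _ _) _.
apply: leq_trans (size_polyMleq _ _) _.
rewrite -subn1 leq_subLR (leq_trans (leq_add (size_rising _ X2) (size_rising _ NX2))) //.
by have := odd_half_doubleS odd_p; lia.
Qed.

(** For odd [a] both sides vanish, the right one through its factor [j = (a-1)/2]. For even [a] they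
    agree at 0 and obey the same recurrence. *)
Lemma red_trunc_sum_nat a : (a < p)%N ->
  oddprod n 0 ^+ 2 * red (trunc_sum (- a%:R)) = oddprod n a%:R ^+ 2.
Proof.
have [oa|] := boolP (odd a).
  move=> ap; rewrite trunc_sum_odd // rmorph0 mulr0 /oddprod.
  have an : (a./2 < n)%N by have := odd_half_doubleS odd_p; have := odd_double_half a; lia.
  rewrite [X in X ^+ 2](_ : _ = 0) ?expr0n // (bigD1 (Ordinal an)) //=.
  by have := odd_double_half a; rewrite oa add1n => ->; rewrite subrr mul0r.
move=> ea; rewrite -(odd_double_half a) (negPf ea) add0n.
elim: a./2 => [|b IH] bp; first by rewrite double0 oppr0 trunc_sum0 // rmorph1 mulr1.
rewrite doubleS in bp *.
have U : b.*2.+2%:R != 0 :> 'F_p by rewrite natFp_eq0 // gtnNdvd.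
apply: (mulfI (expf_neq0 2 U)).
have E : b.*2.+2%:R ^+ 2 * red (trunc_sum (- b.*2.+2%:R)) =
    b.*2.+1%:R ^+ 2 * red (trunc_sum (- b.*2%:R)).
  rewrite -!(rmorph_nat red) -!(rmorphXn red) -!(rmorphM red).
  by congr red; exact: (trunc_sum_rec pr_p odd_p bp).
rewrite mulrCA {}E.
rewrite mulrCA IH ?(ltn_trans _ bp) //.
have := oddprod_rec b.*2%:R (natFp_p pr_p).
by rewrite natr1 -(natrD _ b.*2 2) addn2 -!exprMn [_.+2%:R * _]mulrC => ->; rewrite mulrC.
Qed.

Lemma map_trunc_sumX :
  oddprod n 0 ^+ 2 *: map_poly red (trunc_sumX pr_p) = oddprod n (- 'X) ^+ 2.
Proof.
apply: poly_Fp_ext => //.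
- exact: leq_trans (size_scale_leq _ _) size_red_trunc_sumX.
- apply: leq_trans (size_polyMleq _ _) _.
  have : (size (oddprod n (- 'X) : {poly 'F_p}) <= n.+1)%N.
    apply: (@size_prod_linear _ _ (fun j => j.*2.+1%:R - - 'X)) => j.
    by rewrite opprK addrC size_linear // size_polyX.
  by have := odd_half_doubleS odd_p; lia.
move=> a ap; have := red_trunc_sum_nat ap.
rewrite hornerZ horner_exp -horner_trunc_sum horner_red rmorphN rmorph_nat => ->.
by rewrite horner_oddprod hornerN hornerX opprK.
Qed.

End ModP.

(** * The p-adic Gamma function near 0 *)

Section GammaNearZero.
Context (p : nat) (pr_p : prime p) (odd_p : odd p).
Local Notation Zp := 'Zp[pr_p].
Local Notation half := (2%:R^-1 : Zp).
Local Notation red := (@reduce p pr_p).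
Local Notation n := p./2.

Lemma gammapS (x : Zp) :
  gammap (x + 1) = - (gammap x * (if x \is a GRing.unit then x else 1)).
Proof.
(* Level 0 is trivial and is set apart: only from level 1 on does the residue of [x] decide whether
   [x] is a unit. *)
apply: zres_inj => -[|m].
  by have := zres_lt (gammap (x + 1)) 0; have := zres_lt (- (gammap x *
    (if x \is a GRing.unit then x else 1))) 0; rewrite expn0; lia.
apply/eqmodpP; apply: eqmodp_trans (gammap_mod odd_p _ _) _.
apply: (@eqmodp_trans _ _ _ (gammap_nat pr_p (zres x m.+1).+1)).
  apply: gammap_nat_cong => //.
  by rewrite zresD modn_mod -modnDmr (zres_nat pr_p 1) modn_mod modnDmr addn1.
rewrite gammap_natS -mulN1r -[X in eqmodp _ _ X]mulN1r.
apply: eqmodpM; first exact: eqmodpr.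
apply: eqmodpM; first exact/eqmodp_sym/gammap_mod.
rewrite padic_unitE -{1}(zres_trunc x (ltn0Sn m)) expn1 /dvdn modn_mod -/(dvdn _ _).
case: ifP => _; first exact: eqmodpr.
by apply/eqmodpP; rewrite zres_nat zres_mod.
Qed.

Lemma gammap_shift (x : Zp) k :
  (forall i, (i < k)%N -> x + i%:R \is a GRing.unit) ->
  gammap (x + k%:R) = (-1) ^+ k * rising x k * gammap x.
Proof.
elim: k => [|k IH] xU; first by rewrite /rising big_ord0 addr0 !mul1r.
rewrite -natr1 addrA gammapS IH => [|i ik]; last exact/xU/ltnW.
by rewrite xU // exprS risingS; ring.
Qed.

Lemma eqmodp_nat m (x : Zp) : eqmodp m x (zres x m)%:R.
Proof. by apply/eqmodpP; rewrite zres_nat zres_mod. Qed.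

Lemma red_mulp (x : Zp) : red (p%:R * x) = 0.
Proof. by apply/red_eq0; exists x. Qed.

(** Lagrange's congruence, with [(p-1)!] left unevaluated: both sides have degree below [p], agree
    at 0, and vanish elsewhere on [F_p], the right one by Fermat. *)
Lemma rising_succ_nat_modp :
  rising ('X + 1) p.-1 = (rising 1 p.-1)%:P * (1 - 'X^(p.-1)) :> {poly 'F_p}.
Proof.
have p2 := odd_prime_gt2 odd_p pr_p.
apply: poly_Fp_ext => //.
- rewrite -[X in (_ <= X)%N](prednK (prime_gt0 pr_p)).
  by rewrite size_rising // (@size_linear _ _ 1%N) // size_polyX.
- rewrite mul_polyC; apply: leq_trans (size_scale_leq _ _) _.
  rewrite (leq_trans (size_polyD _ _)) // size_polyN size_polyXn size_poly1.
  by rewrite geq_max; lia.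
move=> [_|a ap].
  rewrite oppr0 horner_rising !hornerE.
  rewrite expr0n (_ : (p.-1 == 0)%N = false); last by lia.
  by rewrite subr0 mulr1.
rewrite horner_rising !hornerE.
have -> : - a.+1%:R + 1 = - a%:R :> 'F_p by ring.
rewrite rising_eq0; last by lia.
suff -> : (- a.+1%:R) ^+ p.-1 = 1 :> 'F_p by rewrite subrr mulr0.
have U : - a.+1%:R != 0 :> 'F_p by rewrite oppr_eq0 natFp_eq0 // gtnNdvd.
apply: (mulfI U); rewrite mulr1 -exprS prednK ?prime_gt0 //.
by have := expf_card (- a.+1%:R : 'F_p); rewrite card_Fp.
Qed.

(** A form of Wolstenholme's theorem. The difference [h] of the two sides, as a polynomial in
    [X = ps], vanishes at 0 and [-p], so [h = k X (X + p)] and [h(ps) = p^2 s (s+1) k(ps)]. It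
    remains to see that [p] divides [k(0)], which modulo [p] is the coefficient of [X^2] in [h]. *)
Lemma rising_succ_modp3 (s : Zp) : p <> 3%N ->
  eqmodp 3 (rising (p%:R * s + 1) p.-1) (rising 1 p.-1).
Proof.
move=> p3; have p2 := odd_prime_gt2 odd_p pr_p.
pose h : {poly Zp} := rising ('X + 1) p.-1 - (rising 1 p.-1)%:P.
have hE x : h.[x] = rising (x + 1) p.-1 - rising 1 p.-1.
  by rewrite /h hornerD hornerN hornerC horner_rising !hornerE.
have h0 : h.[0] = 0 by rewrite hE add0r subrr.
have hp : h.[- p%:R] = 0.
  (* Reversing the order of the factors turns each one into the opposite of a factor of [(p-1)!],
     and there are evenly many. *)
  rewrite hE; apply/eqP; rewrite subr_eq0 /rising (reindex_inj rev_ord_inj) /=.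
  apply/eqP; transitivity (\prod_(j < p.-1) (- (1 + j%:R) : Zp)).
    apply: eq_bigr => j _; have := ltn_ord j => jp.
    have pE : p%:R = p.-1%:R + 1 :> Zp by rewrite natr1 prednK ?prime_gt0.
    by rewrite natrB // pE -natr1; ring.
  rewrite prodrN card_ord -signr_odd (_ : odd p.-1 = false) ?mul1r //.
  by have := odd_half_doubleS odd_p; lia.
have Eh : map_poly red h = rising ('X + 1) p.-1 - (rising 1 p.-1)%:P.
  by rewrite rmorphB /= rmorph_rising rmorphD rmorph1 /= map_polyX map_polyC /=
     rmorph_rising rmorph1.
have [k Dh] := factor0p h0 hp.
have /polyP/(_ 2%N) : map_poly red k * 'X^2 =
    (rising 1 p.-1)%:P * (1 - 'X^(p.-1)) - (rising 1 p.-1)%:P.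
  rewrite -rising_succ_nat_modp -Eh Dh !rmorphM rmorphD /= !map_polyX map_polyC.
  by rewrite /= -[p%:R]mulr1 red_mulp polyC0 addr0 expr2.
rewrite coefMXn /= coefB coefCM coefB coefXn !coefC /=.
(* For [p = 3] the monomial [X^(p-1)] would contribute to this coefficient. *)
rewrite (_ : (2 == p.-1)%N = false) ?subr0 ?mulr0 ?coef1 ?mulr0 ?subr0; last by lia.
rewrite -horner_coef0 => k0.
have /red_eq0[d Dd] : red k.[p%:R * s] = 0 by rewrite horner_red red_mulp.
exists (d * s * (s + 1)); by rewrite -hE Dh !hornerM hornerD hornerC hornerX Dd; ring.
Qed.

(** Modulo [p^3], passing from [ps] to [p(s+1)] multiplies [gammap] by a constant [W] independent of
    [s]. Hence the claim holds for natural [v], where [gammap (p v)] is [W^v], and by continuity for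
    all [v]. *)
Lemma gammap_mulp_add (u v : Zp) : p <> 3%N ->
  eqmodp 3 (gammap (p%:R * u) * gammap (p%:R * v)) (gammap (p%:R * (u + v))).
Proof.
move=> p3; pose W : Zp := - rising 1 p.-1.
have gS s : eqmodp 3 (gammap (p%:R * (s + 1))) (W * gammap (p%:R * s)).
  (* One step leaves the non-unit [ps] and only changes the sign; the other [p - 1] steps start at
     units. *)
  have -> : p%:R * (s + 1) = p%:R * s + 1 + p.-1%:R :> Zp.
    by rewrite mulrDr mulr1 -addrA nat1r prednK ?prime_gt0.
  rewrite gammap_shift => [|i ip]; last first.
    rewrite red_unit !rmorphD rmorph1 /= red_mulp rmorph_nat add0r.
    by rewrite nat1r natFp_eq0 // gtnNdvd //; lia.
  rewrite gammapS red_unit red_mulp eqxx mulr1 mulrN -mulNr.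
  apply: eqmodpM; last exact: eqmodpr.
  rewrite -signr_odd (_ : odd p.-1 = false); last by have := odd_half_doubleS odd_p; lia.
  rewrite mul1r /W -mulN1r -[X in eqmodp _ _ X]mulN1r.
  by apply: eqmodpM; [exact: eqmodpr | exact: rising_succ_modp3].
have gX s k : eqmodp 3 (gammap (p%:R * (s + k%:R))) (W ^+ k * gammap (p%:R * s)).
  elim: k => [|k IH]; first by rewrite addr0 mul1r; exact: eqmodpr.
  rewrite -natr1 addrA exprS -mulrA; apply: eqmodp_trans (gS _) _.
  by apply: eqmodpM; [exact: eqmodpr | exact: IH].
have gC (s t : Zp) : eqmodp 3 s t -> eqmodp 3 (gammap (p%:R * s)) (gammap (p%:R * t)).
  by move=> st; apply: gammap_continuous => //; apply: eqmodpM => //; exact: eqmodpr.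
have [k vk] : exists k, eqmodp 3 v k%:R by exists (zres v 3); exact: eqmodp_nat.
apply: (@eqmodp_trans _ _ _ (gammap (p%:R * u) * W ^+ k)).
  apply: eqmodpM; first exact: eqmodpr.
  apply: eqmodp_trans (gC _ _ vk) _.
  have := gX 0 k; rewrite add0r mulr0 (gammapP pr_p odd_p 0).
  by rewrite /gammap_nat big_geq // mulr1 mulr1.
rewrite mulrC; apply/eqmodp_sym/(eqmodp_trans _ (gX u k))/gC.
by case: vk => c Dc; exists c; rewrite -Dc; ring.
Qed.

End GammaNearZero.

(** * The Gamma quotient and the congruences *)

Section Main.
Context (p : nat) (pr_p : prime p) (odd_p : odd p).
Local Notation Zp := 'Zp[pr_p].
Local Notation half := (2%:R^-1 : Zp).
Local Notation red := (@reduce p pr_p).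
Local Notation n := p./2.

Definition gamma_quot (x : Zp) : Zp :=
  gammap half ^+ 2 /
    (gammap (1 - half * x) ^+ 2 * gammap (half + half * x) ^+ 2).

Lemma gamma_quotP x y :
  gamma_quot x = y <->
  gammap half ^+ 2 = y * (gammap (1 - half * x) * gammap (half + half * x)) ^+ 2.
Proof.
have U : (gammap (1 - half * x) * gammap (half + half * x)) ^+ 2 \is a GRing.unit.
  by rewrite unitrX // unitrM !gammap_unit.
rewrite /gamma_quot -exprMn; split=> [<-|->]; first by rewrite mulrVK.
by rewrite mulrK.
Qed.

Lemma addhalf : half + half = 1.
Proof. by transitivity (2%:R * half); [ring | rewrite mul2half]. Qed.

(** The substitution exchanges the two Gamma arguments of the denominator. *)
Lemma gamma_quotC x : gamma_quot (1 - x) = gamma_quot x.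
Proof.
have E := addhalf.
rewrite /gamma_quot [X in _ / X]mulrC.
have -> : half + half * (1 - x) = 1 - half * x.
  by transitivity (half + half - half * x); [ring | rewrite E].
have -> // : 1 - half * (1 - x) = half + half * x.
by transitivity (half + half - half + half * x); [rewrite E | ]; ring.
Qed.

Lemma gammap0 : gammap (0 : Zp) = 1.
Proof. by rewrite (gammapP pr_p odd_p 0) /gammap_nat big_geq // mulr1. Qed.

Lemma gammap1 : gammap (1 : Zp) = -1.
Proof.
by rewrite -[X in gammap X]add0r gammapS // gammap0 unitr0 mulr1.
Qed.

Lemma gamma_quot0 : gamma_quot 0 = 1.
Proof.
by apply/gamma_quotP; rewrite mulr0 subr0 addr0 gammap1 mulN1r sqrrN mul1r.
Qed.

Lemma gamma_quotN1 : gamma_quot (-1) = 4%:R.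
Proof.
have E := addhalf.
apply/gamma_quotP; rewrite mulrN1 subrr gammap0 opprK addrC gammapS //.
rewrite unitrV unit2 //.
transitivity (gammap half ^+ 2 * (2%:R * half) ^+ 2); last by ring.
by rewrite mul2half // expr1n mulr1.
Qed.

(** Replacing [x] by [x - 2] raises one Gamma argument by 1 and lowers the other by 1. The unit
    conditions select the branch of [gammapS] that yields a factor: [(2-x)/2] for one, [(x-1)/2] for
    the other, up to sign. *)
Lemma gamma_quot_rec x : x - 1 \is a GRing.unit -> x - 2%:R \is a GRing.unit ->
  gamma_quot (x - 2%:R) * (2%:R - x) ^+ 2 = gamma_quot x * (1 - x) ^+ 2.
Proof.
move=> U1 U2; have E := mul2half pr_p odd_p.
have H1 : half * (x - 2%:R) = half * x - 1 by rewrite mulrBr [half * 2%:R]mulrC E.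
have V1 : 1 - half * x \is a GRing.unit.
  have -> : 1 - half * x = - (half * (x - 2%:R)) by rewrite H1 opprB.
  by rewrite unitrN unitrM unitrV unit2.
have D2 : half + half * (x - 2%:R) = half * (x - 1).
  by transitivity (half * x + half - (half + half)); [rewrite H1 addhalf | ]; ring.
have V2 : half + half * (x - 2%:R) \is a GRing.unit.
  by rewrite D2 unitrM unitrV unit2.
have /gamma_quotP := erefl (gamma_quot (x - 2%:R)).
have /gamma_quotP := erefl (gamma_quot x).
have -> : half + half * x = half + half * (x - 2%:R) + 1 by rewrite H1; ring.
rewrite gammapS // V2.
have -> : 1 - half * (x - 2%:R) = 1 - half * x + 1 by rewrite H1; ring.
rewrite gammapS // V1.
move: (gammap_unit odd_p (1 - half * x)) (gammap_unit odd_p (half + half * (x - 2%:R))).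
set g1 := gammap (1 - _); set g2 := gammap (half + _) => Ug1 Ug2 -> Q.
have U : (g1 * g2) ^+ 2 \is a GRing.unit by rewrite unitrX // unitrM Ug1.
apply: (mulIr U).
transitivity (gamma_quot (x - 2%:R) * (- (g1 * (1 - half * x)) * g2) ^+ 2 * 4%:R).
  have -> : 2%:R - x = 2%:R * (1 - half * x) by rewrite mulrBr mulrA E; ring.
  by ring.
rewrite -Q D2.
transitivity (gamma_quot x * (g1 * g2) ^+ 2 * ((2%:R * half) * (x - 1)) ^+ 2).
  by ring.
by rewrite E; ring.
Qed.

(** Iterates [gamma_quot_rec]. It serves for [z] in [p Z_p] in the even case and for [z = 1] in the
    odd case. *)
Lemma gamma_quot_shift b z :
  (forall j, (j < b)%N -> (j.*2.+1%:R + z \is a GRing.unit) &&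
                          (j.*2.+2%:R + z \is a GRing.unit)) ->
  gamma_quot (- b.*2%:R - z) * evenshift b z ^+ 2 =
  gamma_quot (- z) * oddshift b z ^+ 2.
Proof.
elim: b => [|b IH] U; first by rewrite /evenshift /oddshift !big_ord0 oppr0 add0r.
have /andP[U1 U2] := U b (ltnSn b).
rewrite evenshiftS oddshiftS !exprMn mulrCA [RHS]mulrA -IH => [|j jb]; last first.
  exact/U/ltnW.
have -> : - b.+1.*2%:R - z = - b.*2%:R - z - 2%:R by rewrite doubleS; ring.
have -> : b.*2.+2%:R + z = 2%:R - (- b.*2%:R - z) by ring.
rewrite mulrC gamma_quot_rec; first by rewrite -mulrA mulrC; ring.
- by rewrite -unitrN (_ : - _ = b.*2.+1%:R + z) //; ring.
- by rewrite -unitrN (_ : - _ = b.*2.+2%:R + z) //; ring.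
Qed.

Lemma shift_unit b z : (b.*2 < p)%N -> red z = 0 ->
  forall j, (j < b)%N -> (j.*2.+1%:R + z \is a GRing.unit) &&
                         (j.*2.+2%:R + z \is a GRing.unit).
Proof.
move=> bp z0 j jb.
have H k : red (k%:R + z) = k%:R by rewrite [LHS]rmorphD /= z0 addr0 rmorph_nat.
by rewrite !red_unit !H !natFp_eq0 // !gtnNdvd //; lia.
Qed.

Lemma evenshift_unit b z : (b.*2 < p)%N -> red z = 0 ->
  evenshift b z \is a GRing.unit.
Proof.
move=> bp z0; rewrite unitr_prod // => j _.
by have /andP[] := shift_unit bp z0 (ltn_ord j).
Qed.

Lemma trunc_sum_even b : (b.*2 < p)%N ->
  trunc_sum (- b.*2%:R : Zp) = gamma_quot (- b.*2%:R).
Proof.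
elim: b => [|b IH] bp; first by rewrite oppr0 trunc_sum0 gamma_quot0.
rewrite doubleS in bp *.
have U := @lt_nat_unit p pr_p b.*2.+2 bp.
have U1 := @lt_nat_unit p pr_p b.*2.+1 (ltnW bp).
have U2 : b.*2.+2%:R ^+ 2 \is a @GRing.unit Zp by rewrite unitrX.
apply: (mulrI U2); rewrite trunc_sum_rec // IH; last by rewrite ltnW // ltnW.
have := @gamma_quot_rec (- b.*2%:R).
have -> : - b.*2%:R - 1 = - b.*2.+1%:R :> Zp by ring.
have -> : - b.*2%:R - 2%:R = - b.*2.+2%:R :> Zp by ring.
have -> : 1 - - b.*2%:R = b.*2.+1%:R :> Zp by ring.
have -> : 2%:R - - b.*2%:R = b.*2.+2%:R :> Zp by ring.
by rewrite !unitrN mulrC [RHS]mulrC => -> //; exact: mulrC.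
Qed.

(** Put [v = t/2]. Shifting [half] and [half - pv] by [n] gives [p * half] and [p(half - v)], at the
    cost of the factors [oddprod n 0 / 2^n] and [oddprod n (pt) / 2^n] and equal signs. The Gamma
    values left are at multiples of [p], where [gammap_mulp_add] applies. *)
Lemma gamma_quot_mulp t : p <> 3%N ->
  eqmodp 3 (gamma_quot (- (p%:R * t)) * oddprod n 0 ^+ 2)
           (oddprod n (p%:R * t) ^+ 2).
Proof.
move=> p3; have E := mul2half pr_p odd_p.
pose v := half * t; have Dt : t = 2%:R * v by rewrite mulrA E mul1r.
have Dodd i : i.*2.+1%:R = 2%:R * i%:R + 1 :> Zp by rewrite -natr1 -mul2n natrM.
have Dx x i : 2%:R * (half - x + i%:R) = i.*2.+1%:R - 2%:R * x.
  transitivity (2%:R * half - 2%:R * x + 2%:R * i%:R); first by ring.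
  by rewrite E Dodd; ring.
have Un x : red x = 0 -> forall i, (i < n)%N -> half - x + i%:R \is a GRing.unit.
  move=> x0 i ni; suff : 2%:R * (half - x + i%:R) \is a GRing.unit.
    by rewrite unitrM => /andP[].
  rewrite Dx red_unit [red _]rmorphB [X in _ - X]rmorphM /= x0 mulr0 subr0 rmorph_nat.
  by rewrite natFp_eq0 // gtnNdvd //; have := odd_half_doubleS odd_p; lia.
have R x : 2%:R ^+ n * rising (half - x) n = oddprod n (2%:R * x).
  rewrite /rising /oddprod.
  rewrite [RHS](eq_bigr (fun i : 'I_n => 2%:R * (half - x + i%:R))).
    by rewrite big_split prodr_const card_ord.
  by move=> i _; rewrite Dx.
have H x : red x = 0 -> gammap (half - x + n%:R) * 2%:R ^+ n =
    (-1) ^+ n * (oddprod n (2%:R * x) * gammap (half - x)).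
  by move=> x0; rewrite gammap_shift // -?R; [ring | exact: Un].
have Dn : half + n%:R = p%:R * half.
  rewrite (natr_half odd_p); transitivity (half + 2%:R * half * n%:R); last by ring.
  by rewrite E mul1r.
have := gammap_mulp_add odd_p (half - v) v p3; rewrite subrK => HG.
have {HG} : eqmodp 3 (gammap (p%:R * (half - v)) * gammap (p%:R * v) * 2%:R ^+ n)
    (gammap (p%:R * half) * 2%:R ^+ n).
  by apply: eqmodpM => //; exact: eqmodpr.
rewrite mulrAC.
have -> : p%:R * (half - v) = half - p%:R * v + n%:R by rewrite mulrBr -Dn; ring.
have := H 0 (rmorph0 _); rewrite !subr0 mulr0 Dn => ->.
rewrite H ?red_mulp // -[X in eqmodp _ X _]mulrA.
have Us : (-1) ^+ n \is a @GRing.unit Zp by rewrite unitrX // unitrN1.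
move/(eqmodp_mulI Us)/(eqmodpX 2).
have -> : 2%:R * (p%:R * v) = p%:R * t by rewrite Dt; ring.
set G := gammap (half - p%:R * v); set G' := gammap (p%:R * v) => HG.
have UG : (G * G') ^+ 2 \is a GRing.unit by rewrite unitrX // unitrM !gammap_unit.
have /gamma_quotP := erefl (gamma_quot (- (p%:R * t))).
have -> : half * - (p%:R * t) = - (p%:R * v).
  transitivity (- (2%:R * half) * (p%:R * v)); first by rewrite Dt; ring.
  by rewrite E mulN1r.
rewrite opprK [1 + _]addrC gammapS // red_unit red_mulp eqxx mulr1 -/G -/G' => Q.
apply: (eqmodp_mulI UG); apply/eqmodp_sym.
rewrite (_ : _ * oddprod n (p%:R * t) ^+ 2 = (oddprod n (p%:R * t) * G * G') ^+ 2);
  last by ring.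
rewrite (_ : (G * G') ^+ 2 * _ = (oddprod n 0 * gammap half) ^+ 2) //.
by rewrite [RHS]exprMn Q; ring.
Qed.

(** * The congruence for even residues *)

Definition shifted_sumX a : {poly Zp} := trunc_sumX pr_p \Po (- a%:R - 'X).

Lemma horner_shifted_sumX a z : (shifted_sumX a).[z] = trunc_sum (- a%:R - z).
Proof.
rewrite horner_comp horner_trunc_sum hornerD !hornerN hornerX.
by rewrite -polyC_natr hornerC.
Qed.

Lemma red_shifted_sumX a :
  oddprod n 0 ^+ 2 *: map_poly red (shifted_sumX a) = oddprod n ('X + a%:R) ^+ 2.
Proof.
rewrite map_comp_poly rmorphB rmorphN rmorph_nat /= map_polyX.
rewrite -comp_polyZ map_trunc_sumX // rmorphXn rmorph_oddprod rmorphN /=.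
by rewrite comp_polyX opprB opprK.
Qed.

Lemma trunc_sum_modp3_even b t : p <> 3%N -> (b.*2 < p)%N ->
  eqmodp 3 (trunc_sum (- b.*2%:R - p%:R * t)) (gamma_quot (- b.*2%:R - p%:R * t)).
Proof.
move=> p3 bp.
(* By [gamma_quot_shift] and [gamma_quot_mulp], the Gamma quotient at [-2b - z] is congruent to the
   square of [N(z) oddshift(z) / (N(0) evenshift(z))] on [p Z_p]; here the denominators are
   cleared. *)
pose h : {poly Zp} := oddprod n 0 ^+ 2 *: (shifted_sumX b.*2 * evenshift b 'X ^+ 2)
  - oddprod n 'X ^+ 2 * oddshift b 'X ^+ 2.
have hE z : h.[z] = oddprod n 0 ^+ 2 * (trunc_sum (- b.*2%:R - z) * evenshift b z ^+ 2)
    - oddprod n z ^+ 2 * oddshift b z ^+ 2.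
  rewrite /h hornerD hornerN hornerZ hornerM [X in _ - X]hornerM !horner_exp.
  by rewrite horner_shifted_sumX horner_evenshift horner_oddprod horner_oddshift !hornerX.
have hred : map_poly red h = 0.
  have -> : map_poly red h =
      oddprod n 0 ^+ 2 *: (map_poly red (shifted_sumX b.*2) * evenshift b 'X ^+ 2)
      - oddprod n 'X ^+ 2 * oddshift b 'X ^+ 2.
    rewrite rmorphB /= map_polyZ /=; congr (_ *: _ - _).
    - by rewrite rmorphXn /= rmorph_oddprod rmorph0.
    - by rewrite rmorphM rmorphXn /= rmorph_evenshift /= map_polyX.
    - by rewrite rmorphM !rmorphXn /= rmorph_oddprod rmorph_oddshift /= map_polyX.
  rewrite scalerAl red_shifted_sumX -!exprMn oddprod_evenshift ?subrr //.
  by rewrite -polyC_natr natFp_p.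
have zp s : red (p%:R * s) = 0 by rewrite red_mulp.
have S s := gamma_quot_shift (shift_unit bp (zp s)).
have h0 : h.[0] = 0.
  rewrite hE subr0 trunc_sum_even //.
  by have := S 0; rewrite mulr0 subr0 oppr0 gamma_quot0 mul1r => ->; rewrite subrr.
have hp : eqmodp 3 h.[- p%:R] 0.
  have bn : (b <= n)%N by have := odd_half_doubleS odd_p; lia.
  (* The symmetry sends [-2b + p] to minus an even number below [p], where sum and quotient are
     equal. The value of [h] is then 0 only modulo [p^3], because of [gamma_quot_mulp]. *)
  have EN : 1 - (- b.*2%:R - p%:R * -1) = - (n - b).*2%:R :> Zp.
    rewrite doubleB natrB ?leq_double // -!mul2n !natrM (natr_half odd_p); ring.
  have [c Dc] := gamma_quot_mulp (-1) p3.
  rewrite hE -[- p%:R]mulrN1 -trunc_sumC EN trunc_sum_even -?EN ?gamma_quotC; last first.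
    by have := odd_half_doubleS odd_p; lia.
  rewrite (S (-1)); exists (c * oddshift b (p%:R * -1) ^+ 2).
  by rewrite mulrA -Dc; ring.
have := vanish_modp3 t hred h0 hp; rewrite hE => -[c]; rewrite subr0.
move=> Hc; have [d Dd] := gamma_quot_mulp t p3.
have U : (oddprod n 0 * evenshift b (p%:R * t)) ^+ 2 \is a GRing.unit.
  by rewrite unitrX // unitrM oddprod_unit // evenshift_unit.
apply: (eqmodp_mulI U); exists (c - d * oddshift b (p%:R * t) ^+ 2).
transitivity (p%:R ^+ 3 * c - p%:R ^+ 3 * d * oddshift b (p%:R * t) ^+ 2); last by ring.
rewrite -Hc -Dd.
transitivity (oddprod n 0 ^+ 2 * (trunc_sum (- b.*2%:R - p%:R * t) * evenshift b (p%:R * t) ^+ 2)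
  - oddprod n 0 ^+ 2 * (gamma_quot (- b.*2%:R - p%:R * t) * evenshift b (p%:R * t) ^+ 2)).
  by ring.
by rewrite S; ring.
Qed.

(** * The congruence for odd residues *)

Lemma red_gammap (x y : Zp) : red x = red y -> red (gammap x) = red (gammap y).
Proof.
move=> /eqmodp1_red/(gammap_continuous odd_p)/eqmodpP E.
by rewrite /reduce E.
Qed.

Lemma red_gamma_quot (x y : Zp) : red x = red y -> red (gamma_quot x) = red (gamma_quot y).
Proof.
move=> xy; have U z : gammap (1 - half * z) ^+ 2 * gammap (half + half * z) ^+ 2
    \is a GRing.unit by rewrite unitrM !unitrX ?gammap_unit.
have E1 : red (gammap (1 - half * x)) = red (gammap (1 - half * y)).
  by apply: red_gammap; rewrite !rmorphB !rmorphM /= xy.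
have E2 : red (gammap (half + half * x)) = red (gammap (half + half * y)).
  by apply: red_gammap; rewrite !rmorphD !rmorphM /= xy.
rewrite /gamma_quot !rmorph_div ?U //; congr (_ / _).
by rewrite [LHS]rmorphM [RHS]rmorphM !(rmorphXn red) /= E1 E2.
Qed.

(** At [z = -pd] the factor [z(z+p)] is [p^2 d(d-1)], so it suffices that the Gamma quotient is
    [4 k(0)] modulo [p]. Both reduce to 4 times the square of [oddshift b 1 / evenshift b 1]. *)
Lemma trunc_sum_modp3_odd b d : (b.*2.+1 < p)%N ->
  eqmodp 3 (trunc_sum (- b.*2.+1%:R + p%:R * d))
    (p%:R ^+ 2 * d * (d - 1) / 4%:R * gamma_quot (- b.*2.+1%:R + p%:R * d)).
Proof.
move=> ap; have p2 := odd_prime_gt2 odd_p pr_p.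
have g0 : (shifted_sumX b.*2.+1).[0] = 0.
  by rewrite horner_shifted_sumX subr0 trunc_sum_odd //= odd_double.
have gp : (shifted_sumX b.*2.+1).[- p%:R] = 0.
  rewrite horner_shifted_sumX -trunc_sumC.
  (* The reflected index [p - 2b - 2] is odd again, so the sum vanishes there too. *)
  have -> : 1 - (- b.*2.+1%:R - - p%:R) = - (p - b.*2.+2)%:R :> Zp.
    by rewrite natrB //; ring.
  rewrite trunc_sum_odd //; have := odd_half_doubleS odd_p; last by lia.
  by rewrite oddB // odd_p /= odd_double.
have [k Dk] := factor0p g0 gp.
have D : trunc_sum (- b.*2.+1%:R + p%:R * d) =
    p%:R ^+ 2 * d * (d - 1) * k.[p%:R * - d].
  have -> : - b.*2.+1%:R + p%:R * d = - b.*2.+1%:R - p%:R * - d by ring.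
  by rewrite -horner_shifted_sumX Dk !hornerM hornerD hornerC hornerX; ring.
have p0 : p%:R = 0 :> {poly 'F_p} by rewrite -polyC_natr natFp_p.
(* This is the symmetry between the values 1 of the sum at [x = 1] and [x = 0], read through
   [map_trunc_sumX]. *)
have Nm1 : oddprod n (-1) ^+ 2 = oddprod n 0 ^+ 2 :> 'F_p.
  have := congr1 (fun f => f.[1]) (map_trunc_sumX pr_p odd_p).
  rewrite hornerZ horner_exp horner_oddprod hornerN hornerX => <-.
  rewrite -[X in _.[X]](rmorph1 red) horner_map /= horner_trunc_sum.
  by rewrite -trunc_sumC subrr trunc_sum0 ?rmorph1 ?mulr1.
have N0 : oddprod n 0 ^+ 2 != 0 :> 'F_p.
  have := oddprod_unit pr_p odd_p; rewrite red_unit rmorph_oddprod rmorph0.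
  exact: expf_neq0.
pose K := map_poly red k.
have DK : oddprod n 0 ^+ 2 *: (K * 'X^2) = oddprod n ('X + b.*2.+1%:R) ^+ 2.
  rewrite -red_shifted_sumX Dk !rmorphM rmorphD /= !map_polyX map_polyC.
  by rewrite /= -[p%:R]mulr1 red_mulp polyC0 addr0 expr2.
have E1 := @oddprod_evenshift _ odd_p _ b ('X + 1) p0.
(* This recurrence step produces the factor [X] whose square cancels the [X^2] of [DK], so that [K]
   can be evaluated at 0. *)
have E2 := @oddprod_rec _ odd_p _ ('X - 1) p0.
have Dw : 'X - 1 + 2%:R = 'X + 1 :> {poly 'F_p} by ring.
rewrite {}Dw subrK in E2.
have Dw : 'X + 1 + b.*2%:R = 'X + b.*2.+1%:R :> {poly 'F_p} by ring.
rewrite {}Dw in E1.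
have X2 : 'X^2 != 0 :> {poly 'F_p} by rewrite expf_neq0 // polyX_eq0.
pose c0 : 'F_p := oddprod n 0 ^+ 2.
rewrite -/c0 in DK N0 Nm1.
pose ev : {poly 'F_p} := evenshift b ('X + 1).
have EK : c0 *: K * (ev * ('X + 1)) ^+ 2 =
    oddprod n ('X - 1) ^+ 2 * oddshift b ('X + 1) ^+ 2.
  apply: (mulIf X2).
  transitivity (c0 *: (K * 'X^2) * (ev * ('X + 1)) ^+ 2).
    by rewrite -!scalerAl mulrAC.
  rewrite DK; transitivity ((oddprod n ('X + b.*2.+1%:R : {poly 'F_p}) * ev * ('X + 1)) ^+ 2).
    by ring.
  rewrite E1.
  transitivity ((oddprod n ('X + 1) * ('X + 1 : {poly 'F_p})) ^+ 2 * oddshift b ('X + 1) ^+ 2).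
    by ring.
  by rewrite E2; ring.
have {EK} K0 : K.[0] * evenshift b 1 ^+ 2 = oddshift b 1 ^+ 2.
  have := congr1 (fun f => f.[0]) EK.
  rewrite hornerM hornerZ horner_exp hornerM [in RHS]hornerM !horner_exp.
  rewrite horner_evenshift horner_oddprod horner_oddshift !hornerD hornerN !hornerX.
  rewrite hornerC !add0r Nm1 mulr1 -mulrA; exact: mulfI.
have j1 j : (j < b)%N -> (j.*2.+1%:R + 1 \is a @GRing.unit Zp) &&
                          (j.*2.+2%:R + 1 \is a @GRing.unit Zp).
  by move=> jb; rewrite !natr1 !lt_nat_unit //; lia.
have EG := congr1 red (gamma_quot_shift j1).
rewrite gamma_quotN1 // [LHS]rmorphM [RHS]rmorphM !(rmorphXn red) /= in EG.
rewrite rmorph_evenshift rmorph_oddshift rmorph1 rmorph_nat in EG.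
have Uev : evenshift b 1 ^+ 2 != 0 :> 'F_p.
  rewrite expf_neq0 //; apply/prodf_neq0 => j _.
  by have := ltn_ord j; rewrite natr1 natFp_eq0 // => jb; rewrite gtnNdvd //; lia.
have G0 : red (gamma_quot (- b.*2%:R - 1)) = 4%:R * K.[0].
  by apply: (mulIf Uev); rewrite -mulrA K0.
have /red_eq0[c Dc] : red (gamma_quot (- b.*2.+1%:R + p%:R * d) - 4%:R * k.[p%:R * - d]) = 0.
  rewrite [LHS]rmorphB [X in _ - X]rmorphM /= rmorph_nat horner_red red_mulp.
  rewrite -/K -G0 (@red_gamma_quot _ (- b.*2%:R - 1)) ?subrr //.
  rewrite [LHS]rmorphD /= red_mulp addr0; congr red.
  by rewrite -natr1 opprD.
have U4 : 4%:R \is a @GRing.unit Zp.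
  by rewrite (natrM _ 2 2) unitrM unit2.
exists (- (d * (d - 1) / 4%:R * c)).
have -> : gamma_quot (- b.*2.+1%:R + p%:R * d) = 4%:R * k.[p%:R * - d] + p%:R * c.
  by rewrite -Dc; ring.
rewrite D; set q := 4%:R^-1; have q4 : 4%:R * q = 1 by rewrite mulrV.
transitivity (p%:R ^+ 2 * d * (d - 1) * k.[p%:R * - d] * (1 - 4%:R * q)
  - p%:R ^+ 3 * (d * (d - 1) * q * c)); first by ring.
by rewrite q4; ring.
Qed.

End Main.

Theorem theorem6p1 (p : nat) (pr_p : prime p) (odd_p : odd p)
    (alpha : 'Zp[pr_p]) :
  let half : 'Zp[pr_p] := 2%:R^-1 in
  let S := \sum_(k < p)
      poch alpha k * poch (1 - alpha) k * poch half k / (k`!)%:R ^+ 3 in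
  let T := gammap half ^+ 2 /
      (gammap (1 - half * alpha) ^+ 2 * gammap (half + half * alpha) ^+ 2) in
  let r := zres (- alpha) 1 in
  (p <> 3%N -> ~~ odd r -> eqmodp 3 S T) /\
  (odd r ->
     eqmodp 3 S (p%:R ^+ 2 * dashp alpha * (dashp alpha - 1) / 4%:R * T)).
Proof.
move=> half S T r.
have rp : (r < p)%N by have := zres_lt (- alpha) 1; rewrite expn1.
(* Both cases apply with [a = r]; the even one has [-pt] in its argument, whence
   [t = - dashp alpha]. *)
have Da : alpha = - r%:R + p%:R * dashp alpha by rewrite dashpK addrC addrK.
have Dr := odd_double_half r.
split=> [p3 er | or].
  have := @trunc_sum_modp3_even p pr_p odd_p r./2 (- dashp alpha) p3.
  rewrite (negPf er) add0n in Dr; rewrite Dr mulrN opprK -Da.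
  exact.
have := @trunc_sum_modp3_odd p pr_p odd_p r./2 (dashp alpha).
rewrite or add1n in Dr; rewrite Dr -Da.
exact.
Qed.
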